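(* Let $(\mathcal L,(\cdot,\cdot),\mathcal H)$ be an extended affine Lie algebra whose root system $R$ is reduced. Then any reflectable set for $R$ is a root-generating set for $\mathcal L$. In particular, the core $\mathcal L_c$ is a finitely generated Lie algebra.
   Context: A triple $(\mathcal L,(\cdot,\cdot),\mathcal H)$, with $\mathcal L$ a complex Lie algebra, $\mathcal H$ a subalgebra and $(\cdot,\cdot)$ a bilinear form on $\mathcal L$, is an extended affine Lie algebra if: (1) the form is symmetric, invariant and non-degenerate; (2) $\mathcal H$ is nontrivial, finite-dimensional and self-centralizing, and $\mathcal L=\sum_{\alpha\in R}\mathcal L_\alpha$, where $\mathcal L_\alpha=\{x\in\mathcal L\mid[h,x]=\alpha(h)x\ \forall h\in\mathcal H\}$ and $R=\{\alpha\in\mathcal H^*\mid\mathcal L_\alpha\neq\{0\}\}$ (the root system of $\mathcal L$); the form restricted to $\mathcal H$ is non-degenerate and is transferred to $\mathcal H^*$; put $R^0=\{\alpha\in R\mid(\alpha,\alpha)=0\}$, $R^\times=R\setminus R^0$; (3) $R$ is a discrete subset of $\mathcal H^*$; (4) $\mathrm{ad}(x)$ is locally nilpotent for $x\in\mathcal L_\alpha$, $\alpha\in R^\times$; (5) $R^\times$ is connected (not a disjoint union of two nonempty mutually orthogonal subsets), and for every $\sigma\in R^0$ there is $\alpha\in R^\times$ with $\alpha+\sigma\in R$. It is known that (after scaling the form if necessary) the form is real-valued and positive semidefinite on $\mathcal V=\mathrm{span}_{\mathbb R}R$, that $R$ is an extended affine root system in $\mathcal V$, and that $\dim\mathcal L_\alpha=1$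 for $\alpha\in R^\times$. The image $\bar R$ of $R$ in $\mathcal V/\mathcal V^0$ ($\mathcal V^0$ the radical of the form on $\mathcal V$) is an irreducible finite root system, and $R$ is called reduced if $\bar R$ is reduced. For $\alpha\in R^\times$ put $\alpha^\vee=2\alpha/(\alpha,\alpha)$ and $w_\alpha(\beta)=\beta-(\beta,\alpha^\vee)\alpha$. For $P\subseteq R^\times$ let $\mathcal W_P$ be the group generated by $w_\alpha$, $\alpha\in P$. $P$ is a reflectable set for $R$ if $\mathcal W_PP=R^\times$. The core $\mathcal L_c$ is the subalgebra of $\mathcal L$ generated by the $\mathcal L_\alpha$, $\alpha\in R^\times$. $P\subseteq R^\times$ is a root-generating set for $\mathcal L$ if the root spaces $\mathcal L_{\pm\alpha}$, $\alpha\in P$, generate $\mathcal L_c$ as a Lie algebra. *)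

(* Defs.v *)
From HB Require Import structures.
From mathcomp Require Import all_boot all_order all_algebra.
From mathcomp Require Import complex.
From mathcomp Require Import boolp classical_sets functions cardinality reals.
From mathcomp Require Import topology normedtype.

Set Implicit Arguments.
Unset Strict Implicit.
Unset Printing Implicit Defensive.

Import Order.TTheory GRing.Theory Num.Theory.
Import numFieldNormedType.Exports.

Local Open Scope classical_set_scope.
Local Open Scope ring_scope.

HB.mixin Record Lmodule_isLieAlgebra (K : nzRingType) (L : Type)
    of GRing.Lmodule K L := {
  bracket : {bilinear L -> L -> L};
  bracketxx : forall x : L, bracket x x = 0;
  bracket_jacobi : forall x y z : L,
    bracket x (bracket y z) + bracket y (bracket z x)
      + bracket z (bracket x y) = 0
}.

#[short(type="lieAlgType")]
HB.structure Definition LieAlgebra (K : nzRingType) :=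
  {L of Lmodule_isLieAlgebra K L & GRing.Lmodule K L}.

Section LieSubalgebras.
Variables (K : nzRingType) (L : lieAlgType K).
Implicit Types (A S : set L).

Record lie_subalgebra A : Prop := LieSubalgebra {
  lie_subalgebra0 : A 0;
  lie_subalgebraD : forall x y, A x -> A y -> A (x + y);
  lie_subalgebraZ : forall (c : K) x, A x -> A (c *: x);
  lie_subalgebra_bracket : forall x y, A x -> A y -> A (bracket x y)
}.

Definition lie_generated S : set L := smallest lie_subalgebra S.

Definition lie_finitely_generated A : Prop :=
  exists2 S : set L, finite_set S & lie_generated S = A.

Definition ad_locally_nilpotent (x : L) : Prop :=
  forall y : L, exists n : nat, iter n (bracket x) y = 0.

End LieSubalgebras.

Record transformation_group (T : Type) (G : set (T -> T)) : Prop :=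
  TransformationGroup {
    transformation_group1 : G id;
    transformation_groupM : forall f g, G f -> G g -> G (f \o g);
    transformation_groupV : forall f, G f ->
      exists2 g, G g & cancel f g /\ cancel g f
}.

(* The finite-dimensional subalgebra H of L is presented as a finite-dimensional
   vector space together with a linear map i : H -> L, required in
   [extended_affine_lie_algebra] to be injective with a subalgebra as image. In
   this way H^* is the vector space 'Hom(H, K^o). *)
Section ExtendedAffine.
Variables (K : numClosedFieldType) (L : lieAlgType K) (form : {biscalar L}).
Variables (H : vectType K) (i : {linear H -> L}).

Local Notation dual := 'Hom(H, K^o).
Implicit Types (a b v w : dual) (P : set dual).

Definition root_space a : set L :=
  [set x | forall h : H, bracket (i h) x = a h *: x].

Definition roots : set dual := [set a | exists2 x, root_space a x & x != 0].

(* When the form is non-degenerate on H, this is the unique t in H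
   with (t, h) = a(h) for all h in H. *)
Definition dual_vector a : H :=
  xget 0 [set t | forall h : H, form (i t) (i h) = a h].

Definition dual_form a b : K := form (i (dual_vector a)) (i (dual_vector b)).

Definition isotropic_roots : set dual :=
  [set a | roots a /\ dual_form a a = 0].

Definition nonisotropic_roots : set dual := roots `\` isotropic_roots.

(* The topology of the finite-dimensional space H^* over K is that of its spaces
   of coordinates, the choice of the basis being irrelevant. *)
Definition discrete_in_dual P : Prop :=
  let coordinates := passmx.rVof (vbasis {:dual}) @` P in
  coordinates `<=` isolated coordinates.

Record extended_affine_lie_algebra : Prop := ExtendedAffineLieAlgebra {
  eala_form_sym : forall x y, form x y = form y x;
  eala_form_invariant : forall x y z,
    form (bracket x y) z = form x (bracket y z);
  eala_form_nondegenerate : forall x, (forall y, form x y = 0) -> x = 0;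
  eala_cartan_injective : injective i;
  eala_cartan_subalgebra : lie_subalgebra (range i);
  eala_cartan_nontrivial : exists h : H, h != 0;
  eala_cartan_self_centralizing :
    [set x | forall h : H, bracket (i h) x = 0] = range i;
  eala_root_decomposition : forall x : L,
    exists (s : seq dual) (y : dual -> L),
      (forall a, a \in s -> roots a /\ root_space a (y a)) /\
      x = \sum_(a <- s) y a;
  eala_cartan_form_nondegenerate : forall h : H,
    (forall k : H, form (i h) (i k) = 0) -> h = 0;
  eala_roots_discrete : discrete_in_dual roots;
  eala_ad_nilpotent : forall a x,
    nonisotropic_roots a -> root_space a x -> ad_locally_nilpotent x;
  eala_roots_connected : ~ exists A B : set dual,
    [/\ A !=set0, B !=set0, A `|` B = nonisotropic_roots, A `&` B = set0 &
        forall a b, A a -> B b -> dual_form a b = 0];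
  eala_isotropic_nonisolated : forall s, isotropic_roots s ->
    exists2 a, nonisotropic_roots a & roots (a + s)
}.

Definition real_root_span : set dual :=
  [set v | exists (s : seq dual) (c : dual -> K),
     (forall a, a \in s -> roots a /\ c a \is Num.real) /\
     v = \sum_(a <- s) c a *: a].

Definition form_radical : set dual :=
  [set v | real_root_span v /\
           forall w, real_root_span w -> dual_form v w = 0].

(* The class in V / V^0 of an element of V, where V is [real_root_span] and V^0
   is [form_radical]. *)
Definition mod_radical v : set dual := [set w | form_radical (w - v)].

(* In the image of R in V / V^0, the only nonzero real multiples of a nonzero
   root which are again roots are plus and minus that root. *)
Definition reduced_roots : Prop :=
  forall a b (c : K), roots a -> roots b -> c \is Num.real -> c != 0 ->
    mod_radical a <> mod_radical 0 ->
    mod_radical b = mod_radical (c *: a) -> c = 1 \/ c = - 1.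

Definition coroot a : dual := (2 / dual_form a a) *: a.

Definition reflection a b : dual := b - dual_form b (coroot a) *: a.

Definition weyl_group P : set (dual -> dual) :=
  smallest (@transformation_group dual) (reflection @` P).

Definition reflectable_set P : Prop :=
  P `<=` nonisotropic_roots /\
  [set w b | w in weyl_group P & b in P] = nonisotropic_roots.

Definition core : set L :=
  lie_generated (\bigcup_(a in nonisotropic_roots) root_space a).

Definition root_generating_set P : Prop :=
  P `<=` nonisotropic_roots /\
  lie_generated (\bigcup_(a in P) (root_space a `|` root_space (- a))) = core.

End ExtendedAffine.

(* Main.v *)
Require Import Defs.
From HB Require Import structures.
From mathcomp Require Import all_boot all_order all_algebra.
From mathcomp Require Import complex.
From mathcomp Require Import boolp classical_sets cardinality reals.
From mathcomp Require Import topology normedtype.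
From mathcomp Require Import ssrAC ring lra zify.

Set Implicit Arguments.
Unset Strict Implicit.
Unset Printing Implicit Defensive.

Import Order.TTheory GRing.Theory Num.Theory.

Local Open Scope classical_set_scope.
Local Open Scope ring_scope.

(** Let A be the subalgebra generated by the root spaces of the roots in P and
    in - P. A nonisotropic root a gives sl2-triples (e, f, h) with e of weight a
    and f of weight - a, and e and f act locally nilpotently on L. The theory of
    such sl2-modules shows that (ad f)^n maps the weight space of weight n onto
    the one of weight - n. Hence, as soon as A contains the root spaces of a and
    - a, it contains with a root space its image under the reflection at a
    ([root_space_sub_reflection]); applied along a word in the reflections at P,
    this puts the root space of every root in W_P P into A
    ([reflectable_root_generating]).

    For finite generation it is enough to find a finite reflectable set, because
    the root spaces of nonisotropic roots are lines ([root_space_dim1]). Two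
    facts produce it.

    First, there are finitely many nonisotropic roots modulo vectors orthogonal
    to all nonisotropic roots ([finite_classes]): finitely many roots t_j span
    the others, and the class of b is determined by the integers (b, t_j^v),
    which lie in [-6, 6] ([cartan_bounded]). The bound comes from the
    integrality of the Cartan integers of the roots b + 2a and b + 3a of the
    a-string through b: isotropic roots are orthogonal to all roots
    ([isotropic_orthogonal]), so that these two roots are nonisotropic when
    (b, a^v) < -6.

    Second, let S be the set of the s orthogonal to all nonisotropic roots and
    such that a + s is a nonisotropic root. The product of the reflections at
    a + s and a + t translates by 2(s - t) ([reflection_shift]), so that S is
    stable under adding and subtracting 2s for s in S. As a is isolated among
    the roots, the points of S are uniformly separated, and, as in the proof
    that a discrete subgroup of a Euclidean space is finitely generated, a
    finite subset T of S yields all of S by the translations by 2t and - 2t, t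
    in T ([lattice_generated]). The finitely many roots a + t, together with a,
    are then enough to reach the whole class of a ([class_reflectable]). *)

Section IterLinear.
Variables (K : nzRingType) (M : lmodType K) (T : {linear M -> M}).

Lemma iter_linear0 k : iter k T 0 = 0.
Proof. by elim: k => // k IHk; rewrite iterS IHk linear0. Qed.

Lemma iter_linearZ k a x : iter k T (a *: x) = a *: iter k T x.
Proof. by elim: k => // k IHk; rewrite !iterS IHk linearZZ. Qed.

Lemma iter_linearB k x y : iter k T (x - y) = iter k T x - iter k T y.
Proof. by elim: k => // k IHk; rewrite !iterS IHk linearB. Qed.
End IterLinear.

(** * Products of commuting linear factors *)
Section LinearFactors.
Variables (K : fieldType) (M : lmodType K) (D : {linear M -> M}).
Implicit Types (c d : nat -> K) (x y z : M).

Definition shift (a : K) : {linear M -> M} := D \- (a \*: idfun).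

Lemma shiftE a x : shift a x = D x - a *: x.
Proof. by []. Qed.

Definition factors c n : {linear M -> M} :=
  iteri n (fun k (T : {linear M -> M}) => shift (c k) \o T) idfun.

Lemma factorsS c n x : factors c n.+1 x = shift (c n) (factors c n x).
Proof. by []. Qed.

Lemma factors_comm (T : {linear M -> M}) c n x :
  (forall y, T (D y) = D (T y)) -> factors c n (T x) = T (factors c n x).
Proof.
move=> TD; elim: n => [//|n IHn].
by rewrite !factorsS IHn !shiftE [RHS]linearB (linearZZ T) TD.
Qed.

Lemma factorsD c n x : factors c n (D x) = D (factors c n x).
Proof. exact: factors_comm. Qed.

Lemma factors_eigen c n x a :
  D x = a *: x -> factors c n x = (\prod_(k < n) (a - c k)) *: x.
Proof.
move=> Dx; elim: n => [|n IHn]; first by rewrite big_ord0 scale1r.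
rewrite factorsS IHn shiftE big_ord_recr /= (linearZZ D) Dx !scalerA -scalerBl.
by congr (_ *: _); ring.
Qed.

(** Two polynomials in D without a common root generate the unit ideal, so a
    vector killed by both is zero. *)
Lemma factors_coprime_eq0 c m d n x :
  (forall i j, i < m -> j < n -> c i != d j)%N ->
  factors c m x = 0 -> factors d n x = 0 -> x = 0.
Proof.
move=> cd cx; elim: n cd => [//|n IHn] cd; rewrite factorsS => /eqP.
rewrite shiftE subr_eq0 => /eqP Dy; apply: IHn => [i j im jn|].
  exact/cd/(ltn_trans jn).
have := factors_eigen c m Dy; rewrite factors_comm; last by move=> y; rewrite factorsD.
rewrite cx linear0 => /esym/eqP; rewrite scaler_eq0 => /orP[|/eqP//].
by case/prodf_eq0 => i _; rewrite subr_eq0 eq_sym (negPf (cd _ _ _ _)).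
Qed.

Section StableSubspace.
Variable Q : M -> Prop.
Hypotheses (Q0 : Q 0) (QD : forall x, Q x -> Q (D x)).
Hypothesis (QL : forall a x y, Q x -> Q y -> Q (a *: x + y)).

(** Division with remainder of the polynomial with roots d k by X - a: the
    remainder is its value at a. The quotient, applied to x, stays inside any
    D-stable subspace Q containing x, such as a root space. *)
Lemma factors_remainder d n x a : Q x ->
  exists2 z, Q z &
    factors d n x = (\prod_(k < n) (a - d k)) *: x + shift a z.
Proof.
move=> Qx; elim: n => [|n [z Qz IHn]].
  by exists 0; rewrite // linear0 big_ord0 scale1r addr0.
set p := \prod_(k < n) _ in IHn.
exists (p *: x + (- d n *: z + D z)); first by do 2 apply: QL => //; apply: QD.
rewrite factorsS IHn !shiftE big_ord_recr /= -/p.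
rewrite !(linearD D) !(linearZZ D) (linearN D) (linearZZ D) mulrBr scalerBl.
rewrite !(scalerDr, scalerN, scalerA, scaleNr, mulrN, opprD, opprK) !addrA.
rewrite [d n * p]mulrC [a * p]mulrC [a * d n]mulrC.
by rewrite [RHS](ACl (1*6*3*5*8*2*4*7))%AC /= subrr add0r.
Qed.

Lemma factors_solve1 d n x a :
  (forall j, j < n -> a != d j)%N -> Q x -> factors d n x = 0 ->
  exists2 z, Q z & x = shift a z.
Proof.
move=> ad Qx dx; have [z Qz] := factors_remainder d n a Qx.
set p := \prod_(k < n) _; have p0 : p != 0.
  by apply/prodf_neq0 => i _; rewrite subr_eq0; exact: ad.
rewrite dx => /esym/eqP; rewrite addr_eq0 => /eqP px.
exists (- p^-1 *: z); first by rewrite -[_ *: z]addr0; exact: QL.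
by rewrite linearZZ scaleNr -scalerN -px scalerA mulVf// scale1r.
Qed.
End StableSubspace.

(** If the polynomials with roots c and d are coprime, the former acts
    invertibly on the kernel of the latter. *)
Lemma factors_solve (Q : M -> Prop) c m d n x :
  Q 0 -> (forall y, Q y -> Q (D y)) ->
  (forall a y z, Q y -> Q z -> Q (a *: y + z)) ->
  (forall i j, i < m -> j < n -> c i != d j)%N ->
  Q x -> factors d n x = 0 ->
  exists2 z, Q z & x = factors c m z.
Proof.
move=> Q0 QD QL cd Qx dx.
suff [z [Qz _] ->] : exists2 z, Q z /\ factors d n z = 0 & x = factors c m z.
  by exists z.
elim: m cd => [|m IHm] cd; first by exists x.
have [i j im jn|z Qz ->] := IHm; first exact/cd/jn/ltnW.
pose Q' y := Q y /\ factors d n y = 0.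
have [||||//||w Qw ->] := @factors_solve1 Q' _ _ _ d n z (c m).
- by split; rewrite ?linear0.
- by move=> y [Qy dy]; split; [exact: QD | rewrite factorsD dy linear0].
- move=> a y u [Qy dy] [Qu du]; split; first exact: QL.
  by rewrite linearD linearZZ dy du scaler0 addr0.
- by move=> j; exact: cd.
- by case: Qz.
exists w => //; rewrite factorsS factors_comm// => y.
by rewrite !shiftE (linearB D) (linearZZ D).
Qed.
End LinearFactors.

(** * Locally nilpotent sl2-modules *)

Section Sl2.
Variables (K : numFieldType) (M : lmodType K) (E F H : {linear M -> M}).
Hypothesis commEF : forall x, E (F x) - F (E x) = H x.
Hypothesis commHE : forall x, H (E x) = E (H x) + 2 *: E x.
Hypothesis commHF : forall x, H (F x) = F (H x) - 2 *: F x.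
Implicit Types (l : K) (x : M).

(** Twice the Casimir operator EF + FE + H^2/2, plus one. With this normalization, 4FE and
    4EF act on the vectors of weight l by [casimir] minus the squares of l + 1
    and l - 1. *)
Definition casimir : {linear M -> M} :=
  (4 \*: (F \o E)) \+ ((H \o H) \+ ((2 \*: H) \+ idfun)).

Lemma casimirE x : casimir x = 4 *: F (E x) + (H (H x) + (2 *: H x + x)).
Proof. by []. Qed.

Lemma weightE l x k : H x = l *: x -> H (iter k E x) = (l + 2 * k%:R) *: iter k E x.
Proof.
move=> Hx; elim: k => [|k IHk]; first by rewrite mulr0 addr0.
by rewrite iterS commHE IHk linearZZ -scalerDl; congr (_ *: _); rewrite -natr1; ring.
Qed.

Lemma weightF l x k : H x = l *: x -> H (iter k F x) = (l - 2 * k%:R) *: iter k F x.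
Proof.
move=> Hx; elim: k => [|k IHk]; first by rewrite mulr0 subr0.
by rewrite iterS commHF IHk linearZZ -scalerBl; congr (_ *: _); rewrite -natr1; ring.
Qed.

Lemma casimir_weightE l x : H x = l *: x ->
  4 *: F (E x) = shift casimir ((l + 1) ^+ 2) x.
Proof.
move=> Hx; rewrite shiftE casimirE Hx linearZZ Hx -addrA.
rewrite scalerA -[X in _ *: x + (_ + X)]scale1r scalerA -!scalerDl -scalerBl.
by rewrite (_ : _ - _ = 0) ?scale0r ?addr0//; ring.
Qed.

Lemma casimir_weightF l x : H x = l *: x ->
  4 *: E (F x) = shift casimir ((l - 1) ^+ 2) x.
Proof.
move=> Hx; rewrite -[E _](subrK (F (E x))) commEF Hx scalerDr (casimir_weightE Hx).
rewrite !shiftE addrCA scalerA -scaleNr -scalerDl -scaleNr; congr (_ + _ *: _); ring.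
Qed.

Lemma casimirEC l x : H x = l *: x -> E (casimir x) = casimir (E x).
Proof.
move=> Hx; apply: (addIr (- ((l + 1) ^+ 2 *: E x))).
rewrite -linearZZ -linearB -(shiftE casimir) -(casimir_weightE Hx) linearZZ linearZZ.
rewrite (casimir_weightF (weightE 1 Hx)) shiftE /=.
by congr (_ - _ *: _); ring.
Qed.

Lemma casimirFC l x : H x = l *: x -> F (casimir x) = casimir (F x).
Proof.
move=> Hx; apply: (addIr (- ((l - 1) ^+ 2 *: F x))).
rewrite -linearZZ -linearB -(shiftE casimir) -(casimir_weightF Hx) linearZZ linearZZ.
rewrite (casimir_weightE (weightF 1 Hx)) shiftE /=.
by congr (_ - _ *: _); ring.
Qed.

Lemma iter_factors (S T : {linear M -> M}) (c : nat -> K) k x :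
  (forall j, 4 *: T (S (iter j S x)) = shift casimir (c j) (iter j S x)) ->
  (forall m j, iter m T (casimir (iter j S x)) = casimir (iter m T (iter j S x))) ->
  4 ^+ k *: iter k T (iter k S x) = factors casimir c k x.
Proof.
move=> TS TD; elim: k => [|k IHk]; first by rewrite scale1r.
rewrite factorsS -IHk !shiftE linearZZ exprSr -scalerA.
rewrite iterSr iterS -iter_linearZ TS shiftE.
by rewrite iter_linearB iter_linearZ TD scalerBr !scalerA [4 ^+ k * _]mulrC.
Qed.

Lemma iterFE l k x : H x = l *: x ->
  4 ^+ k *: iter k F (iter k E x)
  = factors casimir (fun j => (l + 2 * j%:R + 1) ^+ 2) k x.
Proof.
move=> Hx; apply: iter_factors => [j|m j]; first exact/casimir_weightE/weightE.
elim: m => [//|m IHm]; rewrite !iterS IHm.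
exact: (casimirFC (weightF m (weightE j Hx))).
Qed.

Lemma iterEF l k x : H x = l *: x ->
  4 ^+ k *: iter k E (iter k F x)
  = factors casimir (fun j => (l - 2 * j%:R - 1) ^+ 2) k x.
Proof.
move=> Hx; apply: iter_factors => [j|m j]; first exact/casimir_weightF/weightF.
elim: m => [//|m IHm]; rewrite !iterS IHm.
exact: (casimirEC (weightE m (weightF j Hx))).
Qed.

(** The left-hand side runs over the Casimir values forced by E being nilpotent,
    the right-hand side over those forced by F; they can only meet when the
    weight is an integer in a range bounded by the nilpotency orders. *)
Lemma casimir_values_neq l (i j : nat) : l != i%:R - j%:R ->
  (l + 2 * j%:R + 1) ^+ 2 != (l - 2 * i%:R - 1) ^+ 2.
Proof.
rewrite -[l == _]subr_eq0 -[_ ^+ 2 == _]subr_eq0 => lij.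
rewrite (_ : _ - _ = 4 * (i + j).+1%:R * (l - (i%:R - j%:R))).
  by rewrite mulf_neq0// mulf_neq0// pnatr_eq0.
by rewrite -[(i + j).+1%:R]natr1 natrD; ring.
Qed.

(** The polynomials in the Casimir operator that kill x, obtained from F^m E^m
    and from E^n F^n, must have a common root. This gives the integrality of
    weights, the length of strings and the one-dimensionality of root spaces,
    according to what is known of m and n. *)
Lemma sl2_weight l m n x : H x = l *: x -> x != 0 ->
  iter m E x = 0 -> iter n F x = 0 ->
  exists i j, [/\ (i < n)%N, (j < m)%N & l = i%:R - j%:R].
Proof.
move=> Hx /eqP x0 Ex Fx; apply: contrapT => nij; apply: x0.
apply: (@factors_coprime_eq0 _ _ casimir (fun j => (l + 2 * j%:R + 1) ^+ 2) m
  (fun j => (l - 2 * j%:R - 1) ^+ 2) n x).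
- move=> j i jm inn; apply: casimir_values_neq; apply/eqP => lij.
  by apply: nij; exists i, j.
- by rewrite -iterFE// Ex iter_linear0 scaler0.
- by rewrite -iterEF// Fx iter_linear0 scaler0.
Qed.

(** On weight - m the operator F^m E^m is a polynomial in the Casimir operator
    which is coprime to the one given by E^n F^n, hence invertible where F is
    nilpotent. *)
Lemma sl2_lift (Q : M -> Prop) m n x :
  Q 0 -> (forall a y z, Q y -> Q z -> Q (a *: y + z)) ->
  (forall y, Q y -> H y = (- m%:R) *: y) -> (forall y, Q y -> Q (F (E y))) ->
  Q x -> iter n F x = 0 -> exists2 z, Q z & x = iter m F (iter m E z).
Proof.
move=> Q0 QL QH QFE Qx Fx.
have QZ a y : Q y -> Q (a *: y) by move=> Qy; rewrite -[_ *: _]addr0; exact: QL.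
have := @factors_solve _ _ casimir Q
  (fun j => (- m%:R + 2 * j%:R + 1) ^+ 2) m
  (fun j => (- m%:R - 2 * j%:R - 1) ^+ 2) n x Q0 _ QL _ Qx.
case=> [||| z Qz ->].
- move=> y Qy; have -> : casimir y = 4 *: F (E y) + (- m%:R + 1) ^+ 2 *: y.
    by rewrite (casimir_weightE (QH _ Qy)) shiftE subrK.
  by apply: QL; [exact: QFE | exact: QZ].
- move=> j i jm _; apply: casimir_values_neq; apply/eqP => e.
  have /eqP : (i + m)%:R = j%:R :> K by rewrite natrD -(subrK j%:R i%:R) -e addrAC addNr add0r.
  by rewrite eqr_nat => /eqP ji; move: jm; rewrite -ji ltnNge leq_addl.
- by rewrite -iterEF ?Fx ?iter_linear0 ?scaler0//; exact: QH.
by exists (4 ^+ m *: z); [exact: QZ|rewrite !iter_linearZ -iterFE//; exact: QH].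
Qed.
End Sl2.

(** * Root spaces and sl2-triples *)
Section LieIdentities.
Variables (K : nzRingType) (L : lieAlgType K).
Implicit Types x y z : L.

Lemma bracketDl x y z : bracket (x + y) z = bracket x z + bracket y z.
Proof. exact: linearDl. Qed.

Lemma bracketDr x y z : bracket z (x + y) = bracket z x + bracket z y.
Proof. exact: linearD. Qed.

Lemma bracketZl c x z : bracket (c *: x) z = c *: bracket x z.
Proof. exact: linearZl_LR. Qed.

Lemma bracketZr c x z : bracket z (c *: x) = c *: bracket z x.
Proof. exact: linearZr_LR. Qed.

Lemma bracketNr x z : bracket z (- x) = - bracket z x.
Proof. exact: linearNr. Qed.

Lemma bracketC x y : bracket x y = - bracket y x.
Proof.
apply/eqP; rewrite -addr_eq0; apply/eqP; have := bracketxx (x + y).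
by rewrite bracketDl !bracketDr !bracketxx add0r addr0.
Qed.

Lemma bracket_leibniz x y z :
  bracket x (bracket y z) = bracket (bracket x y) z + bracket y (bracket x z).
Proof.
have /eqP := bracket_jacobi x y z; rewrite -addrA addr_eq0 => /eqP ->.
rewrite opprD addrC; congr (_ + _); first by rewrite [RHS]bracketC.
by rewrite [bracket z x]bracketC bracketNr opprK.
Qed.
End LieIdentities.

(** The arithmetic behind the bound on Cartan integers: for a root b with
    (b, a^v) = - n and (a, b^v) = w, the hypotheses express the integrality of
    u = (a, (b + 2a)^v) and v = (a, (b + 3a)^v), multiplied by w. *)
Lemma string_integers_absurd (n w u v : int) : 7 <= n -> w != 0 ->
  u * (- n - w * 2 * n + w * 2 ^+ 2) = w * (2 * 2 - n) ->
  v * (- n - w * 3 * n + w * 3 ^+ 2) = w * (2 * 3 - n) -> False.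
Proof.
move=> n7 w0 eu ev.
have [w1|wN1] := eqVneq w (- 1).
  have : v * (2 * n - 9) = n - 6 by rewrite w1 in ev; lia.
  have [|] := lerP v 0; nia.
have u0 : u != 0 by apply/eqP => u0; move: eu; rewrite u0; nia.
(* w >= 1 and w <= -2 both contradict this inequality. *)
have le_norm : `|- n - w * 2 * n + w * 2 ^+ 2| <= `|w * (2 * 2 - n)|.
  by rewrite -eu normrM; apply: ler_peMl => //; lia.
have [w_neg|w_pos] := ltrP w 0; nia.
Qed.

Section EalaRoots.
Variables (K : numClosedFieldType) (L : lieAlgType K) (form : {biscalar L}).
Variables (H : vectType K) (i : {linear H -> L}).
Hypothesis eala : extended_affine_lie_algebra form i.

Local Notation dual := 'Hom(H, K^o).
Local Notation Lsp := (root_space i).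
Local Notation R := (Defs.roots i).
Local Notation N := (nonisotropic_roots form i).
Local Notation tv := (dual_vector form i).
Local Notation "'[ a , b ]" := (dual_form form i a b).
Local Notation cartan b a := (dual_form form i b (coroot form i a)).
Local Notation refl := (reflection form i).
Implicit Types (a b c : dual) (x y z : L).

Fact formDl x y z : form (x + y) z = form x z + form y z.
Proof. exact: linearDl. Qed.

Fact formDr x y z : form z (x + y) = form z x + form z y.
Proof. exact: linearD. Qed.

Fact formZl (k : K) x z : form (k *: x) z = k * form x z.
Proof. exact: linearZl_LR. Qed.

Fact formZr (k : K) x z : form z (k *: x) = k * form z x.
Proof. exact: linearZr_LR. Qed.

Fact formNl x z : form (- x) z = - form x z.
Proof. exact: linearNl. Qed.

Let formC := eala_form_sym eala.
Let formA := eala_form_invariant eala.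

Definition cartan_pairing (h : H) : H -> K^o := fun k => form (i h) (i k).

Fact cartan_pairing_linear h : linear (cartan_pairing h).
Proof. by move=> c x y; rewrite /cartan_pairing linearP formDr formZr. Qed.
HB.instance Definition _ h :=
  GRing.isLinear.Build K H K^o _ (cartan_pairing h) (cartan_pairing_linear h).

Definition cartan_to_dual (h : H) : dual := linfun (cartan_pairing h).

Fact cartan_to_dual_linear : linear cartan_to_dual.
Proof.
move=> c x y; apply/lfunP => k; rewrite add_lfunE scale_lfunE !lfunE /=.
by rewrite /cartan_pairing linearP formDl formZl.
Qed.
HB.instance Definition _ :=
  GRing.isLinear.Build K H dual _ cartan_to_dual cartan_to_dual_linear.

(** The form being non-degenerate on the finite-dimensional space H, it
    identifies H with its dual, so the defining property of [dual_vector] is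
    satisfied by some vector. *)
Lemma dual_vectorP a h : form (i (tv a)) (i h) = a h.
Proof.
pose phi := linfun cartan_to_dual.
have phi_inj : lker phi == 0%VS.
  apply/lker0P => x y; rewrite !lfunE /= => xy; apply/eqP; rewrite -subr_eq0.
  apply/eqP/(eala_cartan_form_nondegenerate eala) => k.
  have := congr1 (fun g : dual => g k) xy; rewrite !lfunE /= /cartan_pairing.
  by rewrite linearB formDl formNl => ->; rewrite subrr.
have : a \in limg phi.
  suff -> : limg phi = fullv by rewrite memvf.
  apply/eqP; rewrite eqEdim subvf /= limg_dim_eq ?(eqP phi_inj) ?capv0//.
  by rewrite !dimvf; apply: eq_leq; exact: muln1.
case/memv_imgP => t _ at_.
suff : [set t | forall h, form (i t) (i h) = a h] (tv a) by apply.
  by apply: xgetPex; exists t => k; rewrite at_ lfunE /= lfunE.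
Qed.

Lemma dual_formE a b : '[a, b] = a (tv b).
Proof. exact: dual_vectorP. Qed.

Lemma dual_formC a b : '[a, b] = '[b, a].
Proof. exact: formC. Qed.

Lemma dual_formDl a b c : '[a + b, c] = '[a, c] + '[b, c].
Proof. by rewrite !dual_formE add_lfunE. Qed.

Lemma dual_formZl k a b : '[k *: a, b] = k * '[a, b].
Proof. by rewrite !dual_formE scale_lfunE. Qed.

Lemma dual_formNl a b : '[- a, b] = - '[a, b].
Proof. by rewrite !dual_formE opp_lfunE. Qed.

Lemma dual_formMnl a b n : '[a *+ n, b] = n%:R * '[a, b].
Proof. by rewrite -scaler_nat dual_formZl. Qed.

Lemma dual_formDr a b c : '[a, b + c] = '[a, b] + '[a, c].
Proof. by rewrite !(dual_formC a) dual_formDl. Qed.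

Lemma dual_formZr k a b : '[a, k *: b] = k * '[a, b].
Proof. by rewrite !(dual_formC a) dual_formZl. Qed.

Lemma dual_formNr a b : '[a, - b] = - '[a, b].
Proof. by rewrite !(dual_formC a) dual_formNl. Qed.

Lemma dual_formMnr a b n : '[a, b *+ n] = n%:R * '[a, b].
Proof. by rewrite -scaler_nat dual_formZr. Qed.

Definition dual_form_bilin := (dual_formDl, dual_formDr, dual_formNl, dual_formNr,
  dual_formZl, dual_formZr, dual_formMnl, dual_formMnr).

Lemma cartanE b a : cartan b a = 2 * '[b, a] / '[a, a].
Proof. by rewrite dual_formZr; ring. Qed.

Lemma cartanN b a : cartan b (- a) = - cartan b a.
Proof. by rewrite !cartanE !dual_form_bilin opprK mulrN mulNr. Qed.

Lemma reflectionN a b : refl (- a) b = refl a b.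
Proof. by rewrite /reflection cartanN scaleNr scalerN opprK. Qed.

Lemma nonisotropicP a : N a <-> R a /\ '[a, a] != 0.
Proof.
split=> [[Ra iso]|[Ra /eqP aa]]; split => //.
  by apply/eqP => aa; exact: iso.
by case.
Qed.

Lemma cartan_self a : N a -> cartan a a = 2.
Proof. by move=> /nonisotropicP[_ aa]; rewrite cartanE mulfK. Qed.

Lemma root_space0 a : Lsp a 0.
Proof. by move=> h; rewrite linear0 scaler0. Qed.

Lemma root_space_comb a k x y : Lsp a x -> Lsp a y -> Lsp a (k *: x + y).
Proof.
move=> ax ay h; rewrite bracketDr bracketZr ax ay scalerDr !scalerA.
by rewrite [a h * k]mulrC.
Qed.

Lemma root_space_bracket a b x y :
  Lsp a x -> Lsp b y -> Lsp (a + b) (bracket x y).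
Proof.
move=> ax by_ h; rewrite bracket_leibniz ax by_ bracketZl bracketZr -scalerDl.
by rewrite add_lfunE.
Qed.

Lemma root_space_iter a b n x y :
  Lsp a x -> Lsp b y -> Lsp (b + a *+ n) (iter n (bracket x) y).
Proof.
move=> ax by_; elim: n => [|n IHn]; first by rewrite addr0.
by rewrite iterS mulrS addrCA; exact: root_space_bracket.
Qed.

Lemma dual_vector_bracket a b x :
  Lsp b x -> bracket (i (tv a)) x = '[b, a] *: x.
Proof. by move=> bx; rewrite bx dual_formE. Qed.

Lemma form_root_space a b x y : Lsp a x -> Lsp b y -> form x y != 0 -> b = - a.
Proof.
move=> ax by_ xy; apply/eqP; rewrite eq_sym -subr_eq0 -opprD oppr_eq0.
apply/eqP/lfunP => h; rewrite add_lfunE zero_lfunE.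
have : (a h + b h) * form x y = 0.
  have := formA x (i h) y; rewrite by_ formZr bracketC ax formNl formZl.
  by move=> e; rewrite mulrDl -e addrN.
by move/eqP; rewrite mulf_eq0 (negPf xy) orbF addrC => /eqP.
Qed.

Lemma form_root_dual a x : Lsp a x -> x != 0 -> exists2 y, Lsp (- a) y & form x y != 0.
Proof.
move=> ax; apply: contra_neqP => nex; apply: (eala_form_nondegenerate eala) => z.
have [s [y [sy ->]]] := eala_root_decomposition eala z.
rewrite linear_sum big_seq big1// => b /sy[_ by_]; apply: contrapT => /eqP xy.
by apply: nex; exists (y b); rewrite // -(form_root_space ax by_ xy).
Qed.

(** The bracket has weight 0, so it lies in H, which is its own centralizer; its
    scalar products with H then follow from the invariance of the form. *)
Lemma bracket_opp_roots a x y :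
  Lsp a x -> Lsp (- a) y -> bracket x y = form x y *: i (tv a).
Proof.
move=> ax ay; have : range i (bracket x y).
  rewrite -(eala_cartan_self_centralizing eala) => h.
  by rewrite (root_space_bracket ax ay) addrN zero_lfunE scale0r.
case=> t _ txy; rewrite -txy -linearZZ; congr (i _); apply/eqP.
rewrite -subr_eq0; apply/eqP/(eala_cartan_form_nondegenerate eala) => h.
rewrite linearB linearZZ formDl formNl formZl dual_vectorP txy formA.
by rewrite bracketC ay opp_lfunE scaleNr opprK formZr mulrC subrr.
Qed.

Lemma rootN a : R a -> R (- a).
Proof.
case=> x ax x0; have [y ay xy] := form_root_dual ax x0; exists y => //.
by apply: contra_neq xy => ->; rewrite linear0.
Qed.

Lemma nonisotropicN a : N a -> N (- a).
Proof.
move=> /nonisotropicP[Ra aa]; apply/nonisotropicP; split; first exact: rootN.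
by rewrite !dual_form_bilin opprK.
Qed.

Definition sl2_triple a e f :=
  [/\ Lsp a e, Lsp (- a) f & bracket e f = i (tv (coroot form i a))].

Lemma sl2_tripleP a e : N a -> Lsp a e -> e != 0 -> exists f, sl2_triple a e f.
Proof.
move=> /nonisotropicP[_ aa] ae e0; have [f af ef] := form_root_dual ae e0.
exists ((2 / '[a, a] / form e f) *: f); split => //.
  by rewrite -[_ *: f]addr0; apply: root_space_comb => //; exact: root_space0.
rewrite bracketZr (bracket_opp_roots ae af) scalerA mulfVK//.
rewrite -linearZZ; congr (i _); apply/eqP; rewrite -subr_eq0; apply/eqP.
apply: (eala_cartan_form_nondegenerate eala) => h.
by rewrite linearB linearZZ formDl formNl formZl !dual_vectorP scale_lfunE subrr.
Qed.

Lemma sl2_triple_exists a : N a -> exists e f, sl2_triple a e f.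
Proof.
move=> Na; have /nonisotropicP[[e ae e0] _] := Na.
by have [f ?] := sl2_tripleP Na ae e0; exists e, f.
Qed.

Section TripleAction.
Variables (a : dual) (e f : L).
Hypotheses (Na : N a) (aef : sl2_triple a e f).
Let ad x : {linear L -> L} := bracket x.
Let h := i (tv (coroot form i a)).

Lemma triple_commEF x : ad e (ad f x) - ad f (ad e x) = ad h x.
Proof. by case: aef => _ _ efh; rewrite /ad /= bracket_leibniz efh addrK. Qed.

Lemma triple_commHE x : ad h (ad e x) = ad e (ad h x) + 2 *: ad e x.
Proof.
case: aef => ae _ _; rewrite /ad /= bracket_leibniz (dual_vector_bracket _ ae).
by rewrite cartan_self// bracketZl addrC.
Qed.

Lemma triple_commHF x : ad h (ad f x) = ad f (ad h x) - 2 *: ad f x.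
Proof.
case: aef => _ af _; rewrite /ad /= bracket_leibniz (dual_vector_bracket _ af).
by rewrite dual_formNl cartan_self// bracketZl scaleNr addrC.
Qed.

Lemma triple_nilpE : ad_locally_nilpotent e.
Proof. by case: aef => ae _ _; exact: eala_ad_nilpotent eala _ _ Na ae. Qed.

Lemma triple_nilpF : ad_locally_nilpotent f.
Proof.
by case: aef => _ af _; exact: eala_ad_nilpotent eala _ _ (nonisotropicN Na) af.
Qed.

Lemma triple_eigenvalue b x m n : Lsp b x -> x != 0 ->
  iter m (bracket e) x = 0 -> iter n (bracket f) x = 0 ->
  exists j k, [/\ (j < n)%N, (k < m)%N & cartan b a = j%:R - k%:R].
Proof.
move=> bx; apply: (sl2_weight triple_commEF triple_commHE triple_commHF).
exact: dual_vector_bracket.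
Qed.
End TripleAction.

Lemma cartan_integral a b : N a -> R b -> exists m : int, cartan b a = m%:~R.
Proof.
move=> Na [x bx x0]; have [e [f aef]] := sl2_triple_exists Na.
have [m ex] := triple_nilpE Na aef x; have [n fx] := triple_nilpF Na aef x.
have [j [k [_ _ ->]]] := triple_eigenvalue Na aef bx x0 ex fx.
by exists (j%:Z - k%:Z); rewrite rmorphB.
Qed.

Lemma cartan_signed_nat a b : N a -> R b ->
  exists n : nat, cartan b a = - n%:R \/ cartan b (- a) = - n%:R.
Proof.
move=> Na Rb; have [m] := cartan_integral Na Rb.
case: (intP m) => [|n|n] ban; [exists 0%N | exists n.+1 | exists n.+1].
- by left; rewrite ban oppr0.
- by right; rewrite cartanN ban.
- by left; rewrite ban mulrNz.
Qed.

(** A nonzero vector of weight - n in a module where F is nilpotent is not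
    killed by E^k for k <= n. *)
Lemma root_string a b n k : N a -> R b -> cartan b a = - n%:R -> (k <= n)%N ->
  R (b + a *+ k).
Proof.
move=> Na [x bx x0] ban kn; have [e [f aef]] := sl2_triple_exists Na.
have [m fx] := triple_nilpF Na aef x.
exists (iter k (bracket e) x); first by case: aef => ae _ _; exact: root_space_iter.
apply/eqP => ex; have [j [l [_ lk]]] := triple_eigenvalue Na aef bx x0 ex fx.
move/eqP; rewrite ban eqr_oppLR opprB eq_sym subr_eq -natrD eqr_nat => /eqP lnj.
by move: (leq_trans lk kn); rewrite lnj ltnNge leq_addr.
Qed.

(** Otherwise some nonzero z of weight 2 in the root space of a is orthogonal to
    f, hence killed by ad f: this is impossible for a positive weight when
    ad e is locally nilpotent. *)
Lemma root_space_dim1 a x y : N a -> Lsp a x -> x != 0 -> Lsp a y ->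
  exists k, y = k *: x.
Proof.
move=> Na ax x0 ay; have [f axf] := sl2_tripleP Na ax x0.
have [_ af xf] := axf.
have xf0 : form x f != 0.
  apply/eqP => xf0; have := dual_vector_bracket (coroot form i a) ax.
  rewrite -xf (bracket_opp_roots ax af) xf0 scale0r cartan_self// linear0l.
  by move=> /esym/eqP; rewrite scaler_eq0 (negPf x0) pnatr_eq0.
exists (form y f / form x f); apply/eqP; rewrite -subr_eq0; apply/negP => /negP.
set z := _ - _ => z0.
have az : Lsp a z by rewrite /z addrC -scaleNr; exact: root_space_comb.
have fz : bracket f z = 0.
  rewrite bracketC (bracket_opp_roots az af) /z formDl formNl formZl mulfVK//.
  by rewrite subrr scale0r oppr0.
have [m ez] := triple_nilpE Na axf z.
have [j [k [j0 _ jk]]] := triple_eigenvalue Na axf az z0 ez (fz : iter 1 _ _ = _).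
move: j0 jk; rewrite ltnS leqn0 => /eqP ->; rewrite cartan_self// add0r => /eqP.
by rewrite -subr_eq0 opprK -natrD pnatr_eq0.
Qed.

Lemma root_space_lift a b n x : N a -> cartan b a = - n%:R -> Lsp b x ->
  exists f z, [/\ Lsp (- a) f, Lsp (refl a b) z & x = iter n (bracket f) z].
Proof.
move=> Na ban bx; have [e [f aef]] := sl2_triple_exists Na; have [ae af _] := aef.
have [m fx] := triple_nilpF Na aef x.
have := @sl2_lift _ _ _ _ _ (triple_commEF aef) (triple_commHE Na aef)
  (triple_commHF Na aef) (Lsp b) n m x (root_space0 b) (@root_space_comb b) _ _ bx fx.
case=> [||z bz ->].
- by move=> y yb; rewrite -ban; exact: dual_vector_bracket.
- move=> y yb; rewrite -[b](addKr a); apply: root_space_bracket => //.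
  exact: root_space_bracket.
exists f, (iter n (bracket e) z); split => //.
by rewrite /reflection ban scaleNr opprK scaler_nat; exact: root_space_iter.
Qed.

Lemma reflection_root a b : N a -> R b -> R (refl a b).
Proof.
move=> Na Rb; have [x bx x0] := Rb.
suff main c n : N c -> cartan b c = - n%:R -> R (refl c b).
  have [n [|]] := cartan_signed_nat Na Rb => [|ban]; first exact: main.
  by rewrite -reflectionN; apply: (main _ n) => //; exact: nonisotropicN.
move=> Nc bcn; have [f [z [_ bz xz]]] := root_space_lift Nc bcn bx.
by exists z => //; apply: contra_neq x0 => z0; rewrite xz z0 iter_linear0.
Qed.

(** Up to exchanging a and - a the weight of x is some - n with n >= 0, and x is
    then obtained by applying n times ad f to a vector of the reflected root
    space. *)
Lemma root_space_sub_reflection A a b : lie_subalgebra A -> N a ->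
  Lsp a `<=` A -> Lsp (- a) `<=` A -> Lsp (refl a b) `<=` A -> Lsp b `<=` A.
Proof.
move=> Asub Na aA NaA raA x bx.
have [->|x0] := eqVneq x 0; first exact: lie_subalgebra0.
suff main c n : N c -> cartan b c = - n%:R -> Lsp (- c) `<=` A ->
    Lsp (refl c b) `<=` A -> A x.
  have [|n [|] ban] := @cartan_signed_nat a b Na; first by exists x.
    exact: (main a n).
  by apply: (main (- a) n); rewrite ?opprK ?reflectionN//; exact: nonisotropicN.
move=> Nc bcn cA rA; have [f [z [cf bz ->]]] := root_space_lift Nc bcn bx.
elim: n {bcn} => [|n IHn]; first exact: rA.
by rewrite iterS; apply: lie_subalgebra_bracket IHn => //; exact: cA.
Qed.

Lemma reflection_isometry a b c : N a -> '[refl a b, refl a c] = '[b, c].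
Proof.
move=> /nonisotropicP[_ aa]; rewrite /reflection !dual_form_bilin.
by rewrite (dual_formC a c); field.
Qed.

Lemma reflectionK a : N a -> involutive (refl a).
Proof.
move=> Na b; rewrite /reflection dual_formDl dual_formNl dual_formZl cartan_self//.
by rewrite mulr_natr mulr2n opprD addNKr scaleNr opprK subrK.
Qed.

Lemma nonisotropic_reflection a b : N a -> N b -> N (refl a b).
Proof.
move=> Na /nonisotropicP[Rb bb]; apply/nonisotropicP; rewrite reflection_isometry//.
by split=> //; exact: reflection_root.
Qed.

(** * Isotropic roots and the bound on Cartan integers *)

(** For x and y of weights d and - d, [x, y] acts by the same nonzero scalar k
    on all root spaces a + jd, so x and y act as in a Heisenberg algebra. A
    nonzero vector of weight a is then either not killed by any power of x, or
    some x^p v is nonzero and killed by x; then the commutation rule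
    x y^(s+1) u = (s+1) k y^s u shows that u = x^p v is not killed by any power
    of y. *)
Lemma heisenberg_string a d n : R a -> R d -> '[d, d] = 0 -> '[a, d] != 0 ->
  R (a + d *+ n) \/ R (a - d *+ n).
Proof.
move=> [v av v0] [x dx x0] dd ad; have [y dy xy] := form_root_dual dx x0.
set k := form x y * '[a, d]; have k0 : k != 0 by rewrite mulf_neq0.
have heis b u : Lsp b u -> '[b, d] = '[a, d] ->
    bracket x (bracket y u) = bracket y (bracket x u) + k *: u.
  move=> bu bd; rewrite bracket_leibniz (bracket_opp_roots dx dy) bracketZl.
  by rewrite (dual_vector_bracket _ bu) bd scalerA addrC.
have [xn0|xn] := eqVneq (iter n (bracket x) v) 0; last first.
  by left; exists (iter n (bracket x) v) => //; exact: root_space_iter.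
have ex_p : exists p, iter p (bracket x) v == 0 by exists n; apply/eqP.
right; case: (ex_minnP ex_p) => -[|p] /eqP xp0 pmin; first by rewrite [v]xp0 eqxx in v0.
set u := iter p (bracket x) v.
have u0 : u != 0 by apply/negP => /pmin; rewrite ltnn.
have bu : Lsp (a + d *+ p) u by exact: root_space_iter.
have yu s : Lsp (a + d *+ p + (- d) *+ s) (iter s (bracket y) u).
  exact: root_space_iter.
have xyu s : bracket x (iter s.+1 (bracket y) u)
    = (s.+1%:R * k) *: iter s (bracket y) u.
  elim: s => [|s IHs].
    rewrite /= (heis _ _ bu); last by rewrite !dual_form_bilin dd mulr0 addr0.
    by rewrite [bracket x u]xp0 linear0r add0r mul1r.
  rewrite iterS (heis _ _ (yu s.+1)); last first.
    by rewrite !dual_form_bilin dd !(mulr0, oppr0, addr0).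
  by rewrite IHs bracketZr -scalerDl -[s.+2%:R]natr1 mulrDl mul1r.
have yu0 s : iter s (bracket y) u != 0.
  elim: s => [//|s IHs]; apply: contra_neq IHs => ys0.
  have /esym/eqP := xyu s; rewrite ys0 linear0r scaler_eq0 mulf_eq0 pnatr_eq0.
  by rewrite (negPf k0) => /eqP.
exists (iter (n + p) (bracket y) u) => //.
suff <- : a + d *+ p + - d *+ (n + p) = a - d *+ n by [].
by rewrite mulNrn mulrnDr opprD [- _ - _]addrC addrA addrK.
Qed.

(** If p = (a, d) were nonzero, then with r = (a, a) / 2p the root a + sd, where
    s = n or s = - n, would have norm 2p(r + s). Either it vanishes, or
    (d, (a + sd)^v) = 1 / (r + s) is an integer. In both cases |r + s| <= 1,
    which cannot hold both for n = 1 and for n = 4. *)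
Lemma isotropic_orthogonal a d : R a -> R d -> '[d, d] = 0 -> '[a, d] = 0.
Proof.
move=> Ra Rd dd; apply/eqP/negP => /negP ad.
set p := '[a, d] in ad; set r := '[a, a] / p / 2.
have aaE : '[a, a] = 2 * p * r by rewrite /r; field.
have rs n : exists2 s : K, `|s| = n%:R & `|r + s| <= 1.
  have [s sn Rs] : exists2 s : K, `|s| = n%:R & R (a + s *: d).
    have [|] := @heisenberg_string a d n Ra Rd dd ad => Rs.
      by exists n%:R; rewrite ?normr_nat ?scaler_nat.
    by exists (- n%:R); rewrite ?normrN ?normr_nat// scaleNr scaler_nat.
  exists s => //; have cc : '[a + s *: d, a + s *: d] = 2 * p * (r + s).
    by rewrite !dual_form_bilin dd (dual_formC d a) aaE -/p; ring.
  have [->|rs0] := eqVneq (r + s) 0; first by rewrite normr0.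
  have p2 : 2 * p != 0 by rewrite mulf_neq0 ?pnatr_eq0.
  have [|m] := @cartan_integral (a + s *: d) d _ Rd.
    by apply/nonisotropicP; split; rewrite // cc mulf_neq0.
  rewrite cartanE cc !dual_form_bilin dd (dual_formC d a) -/p mulr0 addr0.
  rewrite invfM mulrA divff// mul1r => rm.
  have rsm : (r + s) * m%:~R = 1 by rewrite -rm divff.
  have m1 : 1 <= `|m%:~R : K|.
    rewrite -intr_norm ler1z; case: (eqVneq m 0) rsm => [->|m0 _]; last by lia.
    by rewrite mulr0z mulr0 => /esym/eqP; rewrite oner_eq0.
  by rewrite -[leRHS](normr1 K) -rsm normrM ler_peMr.
have [s s1 rs1] := rs 1%N; have [t t4 rt4] := rs 4%N.
have : `|t - s| <= 2.
  have -> : t - s = (r + t) - (r + s) by ring.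
  by rewrite (le_trans (ler_normB _ _))// (natrD _ 1 1) lerD.
have : 3 <= `|t - s| by rewrite (le_trans _ (lerB_dist _ _))// s1 t4 -natrB.
by move=> /le_trans/[apply]; rewrite ler_nat.
Qed.

(** If (b, a^v) = - n with n >= 7, the roots b + 2a and b + 3a are not orthogonal
    to a, hence not isotropic, and their Cartan integers with a are
    incompatible. *)
Lemma cartan_bounded a b : N a -> N b ->
  exists2 m : int, cartan b a = m%:~R & `|m| <= 6.
Proof.
move=> Na Nb; have [Rb bb] := (nonisotropicP b).1 Nb.
suff main c n : N c -> cartan b c = - n%:R -> (n <= 6)%N.
  have [n [|] ban] := cartan_signed_nat Na Rb.
    exists (- n%:Z); first by rewrite ban mulrNz.
    by rewrite normrN; have := main a n Na ban; lia.
  exists n%:Z; first by rewrite -[RHS]opprK -ban cartanN opprK.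
  by have := main _ n (nonisotropicN Na) ban; lia.
move=> Nc; have [Rc cc] := (nonisotropicP c).1 Nc; rewrite leqNgt => bcn.
apply/negP => n7; have [w cbw] := cartan_integral Nb Rc.
(* q is the ratio of the norms; all Cartan integers in the plane of b and c
   are functions of n and q. *)
pose q : K := '[b, b] / '[c, c].
have bE : '[b, b] = '[c, c] * q by rewrite /q; field.
have q0 : q != 0 by rewrite mulf_neq0 ?invr_eq0.
have bcE : '[b, c] = - (n%:R / 2) * '[c, c].
  have -> : '[b, c] = (2 * '[b, c] / '[c, c]) * '[c, c] / 2 by field.
  by rewrite -cartanE bcn; ring.
have wq : w%:~R * q = - n%:R.
  by rewrite -cbw cartanE (dual_formC c b) bcE bE; field; rewrite q0.
have string k : (k <= n)%N -> (k.*2 != n)%N ->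
    exists u : int, u%:~R * (q - k%:R * n%:R + k%:R ^+ 2) = 2 * k%:R - n%:R.
  move=> kn k2n; have Rbk := root_string Nc Rb bcn kn.
  set d := b + c *+ k in Rbk.
  have cd : '[c, d] = (2 * k%:R - n%:R) * '[c, c] / 2.
    by rewrite /d !dual_form_bilin (dual_formC c b) bcE; field.
  have ddE : '[d, d] = '[c, c] * (q - k%:R * n%:R + k%:R ^+ 2).
    by rewrite /d !dual_form_bilin (dual_formC c b) bcE bE; field.
  have cd0 : '[c, d] != 0.
    rewrite cd mulf_neq0 ?invr_eq0 ?pnatr_eq0// mulf_neq0//.
    by rewrite subr_eq0 -natrM eqr_nat mul2n.
  have dd0 : '[d, d] != 0.
    by apply: contra_neq cd0; exact: isotropic_orthogonal.
  have [u du] := cartan_integral ((nonisotropicP d).2 (conj Rbk dd0)) Rc.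
  exists u; rewrite -du cartanE cd ddE; field.
  by move: dd0; rewrite ddE mulf_eq0 negb_or andbC.
have string_int k : (k <= n)%N -> (k.*2 != n)%N ->
    exists u : int, u * (- n%:Z - w * k%:Z * n%:Z + w * k%:Z ^+ 2) = w * (2 * k%:Z - n%:Z).
  move=> kn k2n; have [u uE] := string k kn k2n; exists u.
  apply: (@intr_inj K).
  transitivity (w%:~R * (u%:~R * (q - k%:R * n%:R + k%:R ^+ 2)) : K); last first.
    by rewrite uE; ring.
  transitivity (u%:~R * (w%:~R * q - w%:~R * k%:R * n%:R + w%:~R * k%:R ^+ 2) : K).
    by rewrite wq; ring.
  by ring.
have w0 : w != 0.
  apply: contraTneq n7 => w0; move/eqP: wq; rewrite w0 mul0r eq_sym oppr_eq0.
  by rewrite pnatr_eq0 => /eqP ->.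
have [u2 e2] := string_int 2%N ltac:(lia) ltac:(lia).
have [u3 e3] := string_int 3%N ltac:(lia) ltac:(lia).
exact: (@string_integers_absurd n w u2 u3).
Qed.

End EalaRoots.

(** * Separated sets stable under doubled translations *)
Lemma finite_representatives (T : choiceType) (I : finType) (f : T -> I) (A : set T) :
  exists2 s : seq T, (forall x, x \in s -> A x) &
    forall x, A x -> exists2 y, y \in s & f y = f x.
Proof.
have [[x0 _]|noA] := pselect (exists x, A x); last first.
  by exists [::] => // x Ax; case: noA; exists x.
pose fib k : set T := [set x | A x /\ f x = k].
exists [seq xget x0 (fib k) | k <- enum I & `[< exists x, fib k x >]].
  move=> x /mapP[k]; rewrite mem_filter => /andP[/asboolP fk _] ->.
  by case: (xgetPex x0 fk).
move=> x Ax; have fx : exists y, fib (f x) y by exists x.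
exists (xget x0 (fib (f x))); last by case: (xgetPex x0 fx).
apply/mapP; exists (f x) => //; rewrite mem_filter mem_enum inE andbT.
exact/asboolP.
Qed.

(** A finite subset of A whose images span a subspace of maximal dimension. *)
Lemma finite_spanning_subset (K : fieldType) (V : vectType K) (T : eqType)
    (f : T -> V) (A : set T) :
  exists2 s : seq T, (forall x, x \in s -> A x) &
    forall x, A x -> f x \in <<map f s>>%VS.
Proof.
pose spans_dim n := exists s : seq T, (forall x, x \in s -> A x) /\ \dim <<map f s>> = n.
have ex_dim : exists n, `[< spans_dim n >].
  by exists 0%N; apply/asboolP; exists [::]; rewrite span_nil dimv0.
have dim_le n : `[< spans_dim n >] -> (n <= \dim {:V})%N.
  by move=> /asboolP[s [_ <-]]; rewrite dimvS ?subvf.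
case: (ex_maxnP ex_dim dim_le) => n /asboolP[s [sA sn]] nmax.
exists s => // x Ax; suff /eqP -> : <<map f s>>%VS == (<[f x]> + <<map f s>>)%VS.
  exact: (subvP (addvSl _ _) _ (memv_line _)).
rewrite eqEdim addvSr sn; apply/nmax/asboolP; exists (x :: s).
by rewrite /= span_cons; split=> // y; rewrite inE => /orP[/eqP ->//|/sA].
Qed.

Section Lattice.
Variables (R : realType) (G : zmodType) (d : nat).
Variables (u : {additive G -> 'rV[R]_d}) (S : set G) (e : R).
Hypothesis e0 : 0 < e.
Hypothesis SD : forall s t, S s -> S t -> S (t + s *+ 2) /\ S (t - s *+ 2).
Hypothesis S_sep : forall s t, S s -> S t ->
  (forall j, `|u s 0 j - u t 0 j| < e) -> s = t.

(** Two points of S in the same box of side e are equal, and a bounded region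
    meets finitely many boxes. *)
Lemma lattice_finite_bounded (B : R) :
  exists2 T : seq G, (forall t, t \in T -> S t) &
    forall s, S s -> (forall j, `|u s 0 j| <= B) -> s \in T.
Proof.
have [M BM] : exists M : nat, (B + B) / e < M%:R.
  by exists (Num.truncn ((B + B) / e)).+1; exact: truncnS_gt.
pose box (s : G) : {ffun 'I_d -> 'I_M.+1} :=
  [ffun j => inord (Num.truncn ((u s 0 j + B) / e))].
pose SB := [set s | S s /\ forall j, `|u s 0 j| <= B].
have [T TS Tcover] := finite_representatives box SB.
exists T => [t /TS[]//|s Ss sB].
have [t tT bts] := Tcover s (conj Ss sB); have [St tB] := TS _ tT.
suff -> : s = t by []; apply: S_sep => // j.
have x_ge0 r : SB r -> 0 <= (u r 0 j + B) / e.
  case=> _ /(_ j); rewrite ler_norml => /andP[xB _].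
  by rewrite divr_ge0 ?(ltW e0)//; lra.
have x_lt r : SB r -> (Num.truncn ((u r 0 j + B) / e)%R < M.+1)%N.
  move=> Sr; rewrite ltnS truncn_le_nat (le_lt_trans _ (lt_trans BM _)) ?ltr_nat//.
  by rewrite ler_pM2r ?invr_gt0// lerD2r; case: Sr => _ /(_ j); exact: ler_normlW.
have /ffunP/(_ j)/(congr1 val) := bts.
rewrite !ffunE /= !inordK ?x_lt// => eq_trunc; have := truncn_itv (x_ge0 s (conj Ss sB)).
have := truncn_itv (x_ge0 t (conj St tB)); rewrite eq_trunc.
move=> /andP[t1 t2] /andP[s1 s2].
have -> : u s 0 j - u t 0 j = ((u s 0 j + B) / e - (u t 0 j + B) / e) * e.
  by field; rewrite gt_eqF.
rewrite normrM (gtr0_norm e0) gtr_pMl// ltr_norml -natr1 in t2 s2 *.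
by apply/andP; split; lra.
Qed.

Lemma stable_double_sum (P : G -> Prop) (I : Type) (r : seq I) (f : I -> G) (k : I -> int) t :
  (forall j t, P t -> P (t + f j *+ 2) /\ P (t - f j *+ 2)) ->
  P t -> P (t + \sum_(j <- r) f j *+ 2 *~ k j).
Proof.
move=> Pf; elim: r t => [|j r IHr] t Pt; first by rewrite big_nil addr0.
rewrite big_cons addrA; apply: IHr.
have Pn n : P (t + f j *+ 2 *+ n) /\ P (t - f j *+ 2 *+ n).
  elim: n => [|n [IHp IHn]]; first by rewrite addr0 subr0.
  rewrite ![_ *+ 2 *+ n.+1]mulrSr opprD !(addrA t); split.
    exact: (Pf j _ IHp).1.
  exact: (Pf j _ IHn).2.
case: (intP (k j)) => [|n|n]; first by rewrite mulr0z addr0.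
  exact: (Pn n.+1).1.
by rewrite mulrNz; exact: (Pn n.+1).2.
Qed.

(** Let v be a finite subset of S whose image has the same real span as that of
    S. Subtracting from s even multiples of the vectors of v brings the
    coefficients of u s over u v into [0, 2], so that s is reduced to one of
    finitely many elements of S. *)
Lemma lattice_generated : exists2 T : seq G, (forall t, t \in T -> S t) &
  forall P : G -> Prop, (forall t, t \in T -> P t) ->
    (forall s t, s \in T -> S t -> P t -> P (t + s *+ 2) /\ P (t - s *+ 2)) ->
    forall s, S s -> P s.
Proof.
have [v vS vspan] := finite_spanning_subset u S.
pose B := \sum_(x <- v) \sum_j 2 * `|u x 0 j|.
have [T TS Tbounded] := lattice_finite_bounded B.
exists (T ++ v) => [t|P PT PS s Ss]; first by rewrite mem_cat => /orP[/TS|/vS].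
pose n := size (map u v); pose X := in_tuple (map u v).
pose c (j : 'I_n) := coord X j (u s); pose k j := Num.floor (c j / 2).
pose f (j : 'I_n) := nth 0 v j.
have fv j : f j \in v by rewrite mem_nth// -(size_map u) ltn_ord.
have us : u s = \sum_j c j *: u (f j).
  rewrite {1}(coord_span (vspan s Ss : u s \in <<X>>%VS)); apply: eq_bigr => j _.
  by rewrite (nth_map 0)// -(size_map u).
pose t := s - \sum_j f j *+ 2 *~ k j.
have Pstable j r : S r /\ P r ->
    (S (r + f j *+ 2) /\ P (r + f j *+ 2)) /\ (S (r - f j *+ 2) /\ P (r - f j *+ 2)).
  move=> [Sr Pr]; have [? ?] := SD (vS _ (fv j)) Sr.
  have [|? ?] := PS (f j) r _ Sr Pr; first by rewrite mem_cat fv orbT.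
  by do 2 split.
have St : S t.
  have -> : t = s + \sum_j f j *+ 2 *~ (- k j).
    by rewrite /t -sumrN; congr (_ + _); apply: eq_bigr => j _; rewrite mulrNz.
  by apply: stable_double_sum => // j r; exact/SD/vS.
have tT : t \in T.
  apply: Tbounded => // j.
  have -> : u t = \sum_l (c l - 2 * (k l)%:~R) *: u (f l).
    rewrite /t raddfB raddf_sum us -sumrB; apply: eq_bigr => l _ /=.
    rewrite scalerBl raddfMz raddfMn; congr (_ - _).
    by rewrite -scaler_int -scaler_nat scalerA mulrC.
  rewrite summxE (le_trans (ler_norm_sum _ _ _))//.
  have kl l : `|c l - 2 * (k l)%:~R| <= 2.
    have /andP[k1 k2] := floor_itv (c l / 2); rewrite -/(k l) in k1 k2.
    by rewrite ler_norml; rewrite rmorphD /= in k2; apply/andP; split; lra.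
  apply: (@le_trans _ _ (\sum_(l < n) 2 * `|u (f l) 0 j|)).
    by apply: ler_sum => l _; rewrite mxE normrM ler_wpM2r.
  rewrite /B (big_nth 0) big_mkord -(size_map u).
  apply: ler_sum => l _; rewrite (bigD1 j)//= lerDl sumr_ge0// => q _.
  by rewrite mulr_ge0.
have -> : s = t + \sum_j f j *+ 2 *~ k j by rewrite /t subrK.
suff [] : S (t + \sum_j f j *+ 2 *~ k j) /\ P (t + \sum_j f j *+ 2 *~ k j) by [].
apply: (@stable_double_sum (fun r => S r /\ P r)) => //; split => //.
by apply: PT; rewrite mem_cat tT.
Qed.
End Lattice.

Lemma lie_generated_subalgebra (K : nzRingType) (L : lieAlgType K) (S : set L) :
  lie_subalgebra (lie_generated S).
Proof.
split=> [A [Asub _]|x y gx gy A AS|c x gx A AS|x y gx gy A AS].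
- exact: lie_subalgebra0.
- by apply: lie_subalgebraD; [case: AS | exact: gx | exact: gy].
- by apply: lie_subalgebraZ; [case: AS | exact: gx].
- by apply: lie_subalgebra_bracket; [case: AS | exact: gx | exact: gy].
Qed.

(** * Weyl groups and generation of the core *)
Section WeylGroup.
Variables (K : numClosedFieldType) (L : lieAlgType K) (form : {biscalar L}).
Variables (H : vectType K) (i : {linear H -> L}).
Hypothesis eala : extended_affine_lie_algebra form i.

Local Notation dual := 'Hom(H, K^o).
Local Notation Lsp := (root_space i).
Local Notation R := (Defs.roots i).
Local Notation N := (nonisotropic_roots form i).
Local Notation "'[ a , b ]" := (dual_form form i a b).
Local Notation refl := (reflection form i).
Local Notation W := (weyl_group form i).
Implicit Types (a b c s t : dual) (P X : set dual).

Lemma weyl_group_refl P a : P a -> W P (refl a).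
Proof. by move=> Pa G [_]; apply; exists a. Qed.

Lemma weyl_group_comp P f g : W P f -> W P g -> W P (f \o g).
Proof. by move=> Pf Pg G [Gt Gr]; apply: transformation_groupM => //; [exact: Pf|exact: Pg]. Qed.

Lemma weyl_group1 P : W P id.
Proof. by move=> G [Gt _]; exact: transformation_group1. Qed.

Lemma weyl_group_sub P Q : P `<=` Q -> W P `<=` W Q.
Proof.
by move=> PQ f Pf G [Gt Gr]; apply: Pf; split => // _ [a Pa <-]; apply: Gr; exists a => //; exact: PQ.
Qed.

(** The transformations that preserve X and have an inverse preserving X form a
    transformation group, which contains the reflections as these are
    involutions. *)
Lemma weyl_group_stable P X : P `<=` N ->
  (forall a b, P a -> X b -> X (refl a b)) -> forall w b, W P w -> X b -> X (w b).
Proof.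
move=> PN PX w b Ww; move: b.
pose stab (f : dual -> dual) := forall b, X b -> X (f b).
pose G := [set f | stab f /\ exists2 g, stab g & cancel f g /\ cancel g f].
suff [] : G w by [].
apply: Ww; split; last first.
  move=> _ [a Pa <-]; have fK := reflectionK eala (PN _ Pa).
  by split=> [b|]; [exact: PX | exists (refl a) => // b; exact: PX].
split; first by split=> //; exists id.
- move=> f f' [Xf [g Xg [fg gf]]] [Xf' [g' Xg' [fg' gf']]].
  split=> [b Xb|]; first exact/Xf/Xf'.
  exists (g' \o g) => [b Xb|]; first exact/Xg'/Xg.
  by split; apply: can_comp.
- by move=> f [Xf [g Xg [fg gf]]]; exists g => //; split => //; exists f.
Qed.

Lemma reflectable_root_generating P :
  reflectable_set form i P -> root_generating_set form i P.
Proof.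
move=> [PN WP]; split=> //; set A := lie_generated _.
have Asub : lie_subalgebra A by exact: lie_generated_subalgebra.
rewrite eqEsubset; split; apply: smallest_sub => //.
- exact: lie_generated_subalgebra.
- move=> x [a Pa ax]; apply: sub_gen_smallest.
  by case: ax => ax; [exists a|exists (- a)] => //; [exact: PN | exact/(nonisotropicN eala)/PN].
move=> x [a Na ax].
have := Na; rewrite -{1}WP => -[w Ww [b Pb wb]].
suff : Lsp a `<=` A by apply.
have PA c : P c -> Lsp c `<=` A /\ Lsp (- c) `<=` A.
  by move=> Pc; split=> y cy; apply: sub_gen_smallest; exists c => //; [left|right].
rewrite -wb; apply: (@weyl_group_stable P [set c | Lsp c `<=` A]) => //; last first.
  exact: (PA b Pb).1.
move=> c d Pc dA; have [cA NcA] := PA c Pc.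
apply: (root_space_sub_reflection eala Asub (PN _ Pc)) => //.
by rewrite (reflectionK eala (PN _ Pc)).
Qed.

(** The class of b is determined by its Cartan integers with finitely many roots
    spanning the others, and these take at most 13 values each. *)
Lemma finite_classes : exists2 s : seq dual, (forall a, a \in s -> N a) &
  forall b, N b -> exists2 a, a \in s & forall c, N c -> '[b - a, c] = 0.
Proof.
have [t tN tspan] := finite_spanning_subset id N.
rewrite map_id in tspan.
(* The Cartan integers are stored shifted by 6, from [-6, 6] to [0, 12]. *)
pose f b : {ffun 'I_(size t) -> 'I_13} := [ffun j =>
  xget 0 [set m : 'I_13 | dual_form form i b (coroot form i (tnth (in_tuple t) j)) = m%:R - 6]].
have fE b j : N b -> dual_form form i b (coroot form i (tnth (in_tuple t) j)) = (f b j)%:R - 6.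
  move=> Nb; rewrite ffunE.
  apply: (@xgetPex _ 0 [set m : 'I_13 | _ = m%:R - 6]).
  have [m -> m6] := cartan_bounded eala (tN _ (mem_tnth j (in_tuple t))) Nb.
  case: (intP m) m6 => [|n|n] m6.
  - by exists (inord 6); rewrite /= inordK// subrr.
  - exists (inord (n.+1 + 6)); rewrite /= inordK; last by lia.
    by rewrite natrD addrK.
  - exists (inord (6 - n.+1)); rewrite /= inordK; last by lia.
    by rewrite natrB; [rewrite addrAC subrr add0r mulrNz | lia].
have [s sN scover] := finite_representatives f N.
exists s => // b Nb; have [a sa fab] := scover b Nb; exists a => // c Nc.
rewrite (dual_formC eala) (dual_formE eala) (coord_span (tspan c Nc : c \in <<in_tuple t>>%VS)).
rewrite sum_lfunE big1// => j _; rewrite scale_lfunE -(dual_formE eala) (dual_formC eala).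
have := fE b j Nb; rewrite -fab -fE; last exact: sN.
set c' := tnth _ j; have /(nonisotropicP form i)[_ c'c'] : N c' by exact/tN/mem_tnth.
rewrite !(cartanE eala) => /(divIf c'c') ba.
have {}ba : '[a, c'] = '[b, c'] by apply: (@mulfI K 2); rewrite ?pnatr_eq0.
rewrite -(tnth_nth 0) -/c' (dual_formDl eala) (dual_formNl eala) ba subrr.
exact: mulr0.
Qed.

(** * Translations in a class of roots *)
Section Translations.
Variable a : dual.
Hypothesis Na : N a.

Definition shifts : set dual :=
  [set s | N (a + s) /\ forall c, N c -> '[s, c] = 0].

(** A shift t is the difference of the nonisotropic roots a + t and a. *)
Lemma shifts_form s t : shifts s -> shifts t -> '[s, t] = 0.
Proof.
move=> [_ sN] [Nat _]; have := sN _ Nat.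
by rewrite (dual_formDr eala) (sN a)// add0r.
Qed.

Lemma shifts0 : shifts 0.
Proof. by split=> [|c _]; rewrite ?addr0// (dual_formE eala) zero_lfunE. Qed.

Lemma cartan_shift s t : shifts s -> shifts t ->
  dual_form form i (a + t) (coroot form i (a + s)) = 2.
Proof.
move=> Ss St; have [_ aa] := (nonisotropicP _ _ _).1 Na.
rewrite (cartanE eala) !(dual_form_bilin eala) (dual_formC eala a s).
by rewrite (Ss.2 a Na) (St.2 a Na) (shifts_form St Ss) (shifts_form Ss Ss) !addr0 mulfK.
Qed.

(** A shift is orthogonal to every shift and to every nonisotropic root, so all
    Cartan integers among the roots a + s are 2: the reflection at a + s sends
    a + r to - a + (r - 2s), and two such reflections compose to a
    translation. *)
Lemma reflection_shift s t r : shifts s -> shifts t -> shifts r ->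
  refl (a + s) (refl (a + t) (a + r)) = a + (r + (s - t) *+ 2).
Proof.
move=> Ss St Sr; rewrite /reflection (cartan_shift St Sr).
rewrite (dual_formDl eala (a + r)) (dual_formNl eala) (dual_formZl eala).
rewrite (cartan_shift Ss St) (cartan_shift Ss Sr) (_ : 2 - 2 * 2 = - 2); last by ring.
rewrite scaleNr opprK !scaler_nat -[LHS]addrA [- _ + _]addrC -mulrnBl -addrA.
by rewrite opprD addrACA subrr add0r.
Qed.

Lemma shifts_translate s t r : shifts s -> shifts t -> shifts r ->
  shifts (r + (s - t) *+ 2).
Proof.
move=> Ss St Sr; split=> [|c Nc].
  rewrite -reflection_shift//; have [[Ns _] [Nt _]] := (Ss, St).
  by do 2 apply: (nonisotropic_reflection eala) => //; exact: Sr.1.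
rewrite !(dual_form_bilin eala) (Ss.2 c Nc) (St.2 c Nc) (Sr.2 c Nc).
by rewrite subrr mulr0 addr0.
Qed.

Lemma shifts_double s t : shifts s -> shifts t ->
  shifts (t + s *+ 2) /\ shifts (t - s *+ 2).
Proof.
move=> Ss St; have S0 := shifts0; split.
  by rewrite -[s]subr0; exact: shifts_translate.
by rewrite -mulNrn -[- s]add0r; exact: shifts_translate.
Qed.
End Translations.
End WeylGroup.

(** * Finite reflectable sets *)

Section Discreteness.
Import numFieldNormedType.Exports.

Lemma discrete_coordinates (K : numClosedFieldType) (H : vectType K)
    (A : set 'Hom(H, K^o)) a : discrete_in_dual A -> A a ->
  let coords := passmx.rVof (vbasis {:'Hom(H, K^o)}) in
  exists2 e : K, 0 < e &
    forall b, A b -> (forall j, `|coords b 0 j - coords a 0 j| < e) -> b = a.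
Proof.
move=> discA Aa coords; have Ca : [set coords b | b in A] (coords a) by exists a.
have [_ [V Va VA]] := discA _ Ca; have /nbhs_ballP[e /= e0 eV] := Va.
exists e => // b Ab ba; suff cba : coords b = coords a.
  exact: (can_inj (passmx.rVofK (vbasisP _)) cba).
suff : (V `&` [set coords b | b in A]) (coords b) by rewrite VA.
split; last by exists b.
by apply: eV; split => // k j; rewrite ord1 /ball /= distrC.
Qed.
End Discreteness.

Section RealCoordinates.
Variables (R : realType) (H : vectType R[i]).
Local Notation dual := 'Hom(H, R[i]^o).
Local Notation coords := (passmx.rVof (vbasis {:dual})).

Definition real_coords (a : dual) :=
  row_mx (map_mx (@complex.Re R) (coords a)) (map_mx (@complex.Im R) (coords a)).

Fact real_coords_is_additive : zmod_morphism real_coords.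
Proof.
move=> a b; have coordsB : coords (a - b) = coords a - coords b by apply/rowP => j; rewrite !mxE linearB.
rewrite /real_coords coordsB opp_row_mx add_row_mx.
by congr row_mx; apply/rowP => j; rewrite !mxE raddfB.
Qed.
HB.instance Definition _ :=
  GRing.isZmodMorphism.Build _ _ real_coords real_coords_is_additive.

Lemma complex_norm_lt (z eps : R[i]) : 0 < eps ->
  `|complex.Re z| < complex.Re eps / 2 -> `|complex.Im z| < complex.Re eps / 2 ->
  `|z| < eps.
Proof.
rewrite normc_def !ltcE /= => /andP[/eqP eps_im eps0]; rewrite !ltr_norml => /andP[x1 x2] /andP[y1 y2].
rewrite eps_im eqxx /= -[ltRHS]ger0_norm ?(ltW eps0)// -sqrtr_sqr.
rewrite ltr_sqrt; nra.
Qed.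

Lemma discrete_real_coords (A : set dual) a : discrete_in_dual A -> A a ->
  exists2 e : R, 0 < e &
    forall b, A b -> (forall j, `|real_coords b 0 j - real_coords a 0 j| < e) -> b = a.
Proof.
move=> discA Aa.
have [eps eps0 sep] := discrete_coordinates discA Aa.
exists (complex.Re eps / 2) => [|b Ab ba].
  by move: eps0; rewrite ltcE => /andP[_ /= e0]; rewrite divr_gt0.
apply: sep => // j; apply: complex_norm_lt => //; rewrite raddfB /=.
  by have := ba (lshift _ j); rewrite !row_mxEl !mxE.
by have := ba (rshift _ j); rewrite !row_mxEr !mxE.
Qed.
End RealCoordinates.

Section Finiteness.
Variables (R : realType) (L : lieAlgType R[i]) (form : {biscalar L}).
Variables (H : vectType R[i]) (i : {linear H -> L}).
Hypothesis eala : extended_affine_lie_algebra form i.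

Local Notation dual := 'Hom(H, R[i]^o).
Local Notation Lsp := (root_space i).
Local Notation N := (nonisotropic_roots form i).
Local Notation "'[ a , b ]" := (dual_form form i a b).
Local Notation W := (weyl_group form i).
Implicit Types (a b c : dual).

(** The list s consists of a and of the a + t for t in a finite set of shifts
    generating all shifts under doubled translations: as these translations are
    products of two reflections at elements of s, all of the class of a is in
    the orbit of s. *)
Lemma class_reflectable a : N a -> exists2 s : seq dual, (forall b, b \in s -> N b) &
  forall b, N b -> (forall c, N c -> '[b - a, c] = 0) ->
  exists2 w, W [set` s] w & exists2 c, c \in s & w c = b.
Proof.
move=> Na; pose S := shifts form i a.
have [e e0 sep] := discrete_real_coords (eala_roots_discrete eala) Na.1.
(* Separation: 2(s - t) is again a shift, and a is isolated among the roots. *)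
have S_sep s t : S s -> S t ->
    (forall j, `|real_coords s 0 j - real_coords t 0 j| < e / 2) -> s = t.
  move=> Ss St st; apply/eqP; rewrite -subr_eq0.
  have [Nst _] := shifts_translate eala Na Ss St (shifts0 eala Na).
  have : a + (0 + (s - t) *+ 2) = a.
    apply: sep => [|j]; first exact: Nst.1.
    rewrite (_ : _ - _ = (real_coords s 0 j - real_coords t 0 j) * 2).
      by rewrite normrM normr_nat -ltr_pdivlMr.
    have -> : real_coords (a + (0 + (s - t) *+ 2)) =
        real_coords a + (real_coords s - real_coords t) *+ 2.
      by rewrite add0r raddfD raddfMn raddfB.
    move: (real_coords a) (real_coords s) (real_coords t) => ca cs ct.
    by rewrite mulr2n !mxE; ring.
  move/eqP; rewrite add0r -[X in _ == X]addr0 (inj_eq (addrI a)) -scaler_nat.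
  by rewrite scaler_eq0 pnatr_eq0.
have [T TS Tgen] := lattice_generated (divr_gt0 e0 (ltr0Sn _ 1)) (@shifts_double _ _ _ _ _ eala a Na) S_sep.
exists [seq a + t | t <- 0 :: T] => [b|b Nb ba].
  case/mapP => t; rewrite inE => /orP[/eqP ->|/TS[Nt _]] -> //.
  by rewrite addr0.
set s := [seq _ | _ <- _].
pose orbit r := exists2 w, W [set` s] w & exists2 c, c \in s & w c = a + r.
have Wrefl t : t \in 0 :: T -> W [set` s] (reflection form i (a + t)).
  by move=> tT; apply: weyl_group_refl; rewrite /=; exact: map_f.
have step t t' r : t \in 0 :: T -> t' \in 0 :: T -> S r -> orbit r ->
    orbit (r + (t - t') *+ 2).
  have TS0 q : q \in 0 :: T -> S q.
    by rewrite inE => /orP[/eqP ->|/TS//]; exact: shifts0.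
  move=> tT t'T Sr [w Ww [c sc wc]].
  exists (reflection form i (a + t) \o (reflection form i (a + t') \o w)).
    by do 2 (apply: weyl_group_comp; first exact: Wrefl).
  by exists c; rewrite //= wc reflection_shift//; exact: TS0.
have T0 : 0 \in 0 :: T by rewrite mem_head.
have Tcons t : t \in T -> t \in 0 :: T by move=> tT; rewrite inE tT orbT.
have <- : a + (b - a) = b by rewrite addrC subrK.
apply: (Tgen orbit) => [t tT|t r tT Sr orb|].
- exists id; first exact: weyl_group1.
  by exists (a + t) => //; exact/map_f/Tcons.
- split; first by rewrite -[t]subr0; exact: step (Tcons _ tT) T0 Sr orb.
  by rewrite -mulNrn -[- t]add0r; exact: step T0 (Tcons _ tT) Sr orb.
- by split => //; rewrite addrC subrK.
Qed.

Lemma finite_reflectable_set :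
  exists P : seq dual, reflectable_set form i [set` P].
Proof.
have [s sN scover] := finite_classes eala.
pose covers a (t : seq dual) := N a -> (forall b, b \in t -> N b) /\
  forall b, N b -> (forall c, N c -> '[b - a, c] = 0) ->
    exists2 w, W [set` t] w & exists2 c, c \in t & w c = b.
have [g gP] : {g : dual -> seq dual & forall a, covers a (g a)}.
  apply: choice => a.
  have [/class_reflectable[t tN torb]|nNa] := pselect (N a); last by exists [::].
  by exists t.
have PN : [set` flatten (map g s)] `<=` N.
  by move=> b /= /flatten_mapP[a sa bga]; exact: (gP a (sN a sa)).1.
exists (flatten (map g s)); split=> //; rewrite eqEsubset; split=> [b|b Nb].
  case=> w Ww [c Pc <-]; apply: (weyl_group_stable eala PN) (PN _ Pc) => //.
  by move=> a d Pa; apply: (nonisotropic_reflection eala); exact: PN.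
have [a sa ab] := scover b Nb; have [w Ww [c gc wc]] := (gP a (sN a sa)).2 b Nb ab.
have gaP : [set` g a] `<=` [set` flatten (map g s)].
  by move=> d /= gd; apply/flatten_mapP; exists a.
by exists w; [exact: weyl_group_sub Ww | exists c => //; exact: gaP].
Qed.

(** One nonzero vector in each of the root spaces of a and - a, for a in a finite
    reflectable set: these root spaces are lines. *)
Lemma core_finitely_generated : lie_finitely_generated (core form i).
Proof.
have [P Pref] := finite_reflectable_set.
have [PN Pgen] := reflectable_root_generating eala Pref.
pose spans a x := N a -> Lsp a x /\ x != 0.
have [v vP] : {v : dual -> L & forall a, spans a (v a)}.
  apply: choice => a.
  have [[[x ax x0] _]|nNa] := pselect (N a); last by exists 0.
  by exists x.
pose Q := P ++ map -%R P.
have QN a : a \in Q -> N a.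
  rewrite mem_cat => /orP[/PN//|/mapP[b Pb ->]].
  exact/(nonisotropicN eala)/PN.
have QL a : a \in Q -> Lsp a `<=` lie_generated [set` map v Q].
  move=> Qa x ax; have [va va0] := vP a (QN a Qa).
  have [k ->] := root_space_dim1 eala (QN a Qa) va va0 ax.
  apply: (lie_subalgebraZ (lie_generated_subalgebra _)).
  by apply: sub_gen_smallest; exact: map_f.
exists [set` map v Q]; first exact: finite_seq.
rewrite eqEsubset; split; last first.
  rewrite -Pgen; apply: smallest_sub; first exact: lie_generated_subalgebra.
  move=> x [a Pa [ax|ax]]; [apply: (QL a)|apply: (QL (- a))] => //.
    by rewrite mem_cat Pa.
  by rewrite mem_cat map_f ?orbT.
apply: smallest_sub; first exact: lie_generated_subalgebra.
move=> _ /mapP[a Qa ->]; apply: sub_gen_smallest; exists a; first exact: QN.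
exact: (vP a (QN a Qa)).1.
Qed.
End Finiteness.

Theorem lemma6p2p2 (R : realType) (L : lieAlgType R[i]) (form : {biscalar L})
    (H : vectType R[i]) (i : {linear H -> L})
    (eala : extended_affine_lie_algebra form i)
    (reduced : reduced_roots form i) :
  (forall P : set 'Hom(H, R[i]^o),
     reflectable_set form i P -> root_generating_set form i P) /\
  lie_finitely_generated (core form i).
Proof.
split=> [P|]; first exact: reflectable_root_generating.
exact: core_finitely_generated.
Qed.
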